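(* Let $K\subseteq\mathbb{R}^n$ be a nonempty closed convex cone, $b\in\mathbb{R}^m$, and let $A\in\mathbb{R}^{m\times n}$ have full rank with $m\le n$. Let $$v=P_{\overline{K-\{x\mid Ax=b\}}}(\mathbf{0}),$$ and let $d$ be any vector with $d\in\operatorname{relint}K$. Then the constraint $K\cap\{x\mid A(x-v-d)=b\}$ is strongly feasible, i.e., there is an $x$ such that $$x\in\operatorname{relint}K\cap\{x\mid A(x-v-d)=b\}.$$
   Context: A set $K\subseteq\mathbb{R}^n$ is a cone if $K=\lambda K$ for every $\lambda>0$. $\operatorname{relint}$ denotes relative interior, $K-\{x\mid Ax=b\}$ is the Minkowski difference $\{y-x\mid y\in K,\ Ax=b\}$, the overline denotes closure, and $P_C$ is the Euclidean projection onto a nonempty closed convex set $C$. *)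

(* Defs.v *)
From mathcomp Require Import all_boot all_order all_algebra.
From mathcomp Require Import all_classical all_reals all_analysis.

Set Implicit Arguments.
Unset Strict Implicit.
Unset Printing Implicit Defensive.

Import Order.TTheory GRing.Theory Num.Theory.
Import numFieldNormedType.Exports.

Local Open Scope classical_set_scope.
Local Open Scope ring_scope.

(* No sign or zero condition: a cone need not contain 0. *)
Definition is_cone (R : realType) (n : nat) (K : set 'cV[R]_n) : Prop :=
  forall l : R, 0 < l -> K = [set l *: x | x in K].

(* The scalar t is arbitrary, so whole lines are required, not segments. *)
Definition is_affine (R : realType) (n : nat) (M : set 'cV[R]_n) : Prop :=
  forall (x y : 'cV[R]_n) (t : R), M x -> M y -> M ((1 - t) *: x + t *: y).

Definition affine_hull (R : realType) (n : nat) (S : set 'cV[R]_n) :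
    set 'cV[R]_n :=
  smallest (@is_affine R n) S.

(* Neighbourhoods come from the library's sup norm on matrices, which induces
   the Euclidean topology. *)
Definition relint (R : realType) (n : nat) (S : set 'cV[R]_n) :
    set 'cV[R]_n :=
  [set x | affine_hull S x /\ \forall y \near x, affine_hull S y -> S y].

Definition minkowski_diff (R : realType) (n : nat) (K L : set 'cV[R]_n) :
    set 'cV[R]_n :=
  [set y - x | y in K & x in L].

(* The library norm `|x| on matrices is the sup norm, hence this one. *)
Definition euclidean_norm (R : realType) (n : nat) (x : 'cV[R]_n) : R :=
  Num.sqrt (\sum_(i < n) x i 0 ^+ 2).

Definition is_euclidean_proj (R : realType) (n : nat) (C : set 'cV[R]_n)
    (x p : 'cV[R]_n) : Prop :=
  C p /\ forall y, C y -> euclidean_norm (x - p) <= euclidean_norm (x - y).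

(* Total function; its value is meaningful when a nearest point exists and is
   unique, in particular when C is nonempty, closed and convex. *)
Definition euclidean_proj (R : realType) (n : nat) (C : set 'cV[R]_n) (x : 'cV[R]_n) :
    'cV[R]_n :=
  get [set p | is_euclidean_proj C x p].

(* Main.v *)
Require Import Defs.
From mathcomp Require Import all_boot all_order all_algebra.
From mathcomp Require Import all_classical all_reals all_analysis.

Set Implicit Arguments.
Unset Strict Implicit.

Import Order.TTheory GRing.Theory Num.Theory.
Import numFieldNormedType.Exports.

Local Open Scope classical_set_scope.
Local Open Scope ring_scope.

(** Write [L = {x | A x = b}] and let [S] be the affine hull of [K], which is a
    linear subspace since [K] is a cone. The set [closure (K - L)] is closed
    and nonempty ([L] is nonempty as [A] is onto), so the projection [v] of the
    origin exists and lies in it ([euclidean_proj_in]). Hence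
    [b + A v] lies in the closure of the convex cone [A K], and adding [A d], a
    relative interior point of [A K], leads into [A (relint K)].

    Concretely, [K - L] has points [y - x] with arbitrarily small error
    [e = v - (y - x)], and [A y + A e = b + A v]. By finite dimension [A]
    restricted to [S] has a continuous right inverse on [A S]
    ([subspace_section]), so that [A e = A w] for a small [w] in [S]. Then
    [d + w] is still in [relint K] ([relint_near]), and so is [y + (d + w)]
    because a convex cone absorbs the addition of its own points
    ([relint_addl]). The image of this point under [A] is [b + A v + A d]
    ([strongly_feasible_of_closure]). *)

(** * Existence of the projection *)

Lemma coordinatewise_continuous (R : realType) (T : topologicalType) (m n : nat)
    (f : T -> 'M[R]_(m, n)) :
  (forall i j, continuous (fun t => f t i j)) -> continuous f.
Proof.
move=> f_cont t D [P nbhsP PD].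
have : \forall s \near t, forall i j, P i j (f s i j).
  apply: filter_forall => i; apply: filter_forall => j.
  exact: f_cont (nbhsP i j).
by apply: filterS => s Ps; exact: PD.
Qed.

Lemma mulmx_continuous (R : realType) (m n : nat) (M : 'M[R]_(m, n)) :
  continuous (fun x : 'cV[R]_n => M *m x).
Proof.
apply: coordinatewise_continuous => i j.
rewrite (_ : (fun x => _) = (fun x : 'cV[R]_n => \sum_k M i k * x k j)); last first.
  by apply/funext => x; rewrite mxE.
apply: (continuous_big (@add_continuous R^o)) => k _ x.
exact: (cvgM (cvg_cst (M i k)) (@coord_continuous R n 1 k j x)).
Qed.

Lemma euclidean_norm_continuous (R : realType) (n : nat) :
  continuous (@euclidean_norm R n).
Proof.
move=> x; apply: (@continuous_comp _ _ _
  (fun y : 'cV[R]_n => \sum_(i < n) y i 0 ^+ 2) Num.sqrt); last exact: sqrt_continuous.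
move: x; apply: (continuous_big (@add_continuous R^o)) => k _ x.
by have yk := @coord_continuous R n 1 k 0 x; exact: (cvgM yk yk).
Qed.

Lemma sup_norm_le_euclidean_norm (R : realType) (n : nat) (u : 'rV[R]_n) :
  `|u| <= euclidean_norm u^T.
Proof.
rewrite [leLHS]/Num.norm /= mx_normrE; apply/bigmax_leP; split=> [|[i j] _ /=].
  exact: sqrtr_ge0.
rewrite -sqrtr_sqr ler_wsqrtr// (bigD1 j)//= mxE (ord1 i) lerDl.
by apply: sumr_ge0 => k _; exact: sqr_ge0.
Qed.

(** Minimize over the points of [C] at least as close to [x] as a given one, a
    compact set. The transposition serves to apply the compactness of bounded
    closed sets of row vectors. *)
Lemma euclidean_proj_exists (R : realType) (n : nat) (C : set 'cV[R]_n)
    (x : 'cV[R]_n) :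
  closed C -> C !=set0 -> exists p, is_euclidean_proj C x p.
Proof.
move=> C_closed [c Cc].
pose f (u : 'rV[R]_n) := euclidean_norm (x - u^T).
have tr_cont : continuous (fun u : 'rV[R]_n => u^T).
  apply: coordinatewise_continuous => i j.
  rewrite (_ : (fun u => _) = fun u : 'rV[R]_n => u j i); first exact: coord_continuous.
  by apply/funext => u; rewrite mxE.
have f_cont : continuous f.
  move=> u; apply: (@continuous_comp _ _ _ (fun u : 'rV[R]_n => x - u^T)).
    exact: (cvgB (cvg_cst x) (tr_cont u)).
  exact: euclidean_norm_continuous.
pose D := (fun u : 'rV[R]_n => u^T) @^-1` C `&` f @^-1` [set r | r <= f c^T].
have Dc : D c^T by rewrite /D /= trmxK.
have D_compact : compact D.
  apply: bounded_closed_compact; last first.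
    by apply: closedI; apply: preimage_closed.
  exists (`|x^T| + f c^T); split; first exact: num_real.
  move=> M ltM u [_ /= fu]; apply: le_trans (ltW ltM).
  rewrite -[u](subKr x^T) (le_trans (ler_normB _ _))// lerD2l.
  by rewrite (le_trans _ fu)// /f -{2}[x]trmxK -linearB/= sup_norm_le_euclidean_norm.
have [|u + umin] := EVT_min_rV (ex_intro _ _ Dc) D_compact (f := f).
  exact: continuous_subspaceT.
rewrite inE => -[Cu fu]; exists u^T; split=> // y Cy.
have [fy|/ltW fy] := leP (f y^T) (f c^T).
  have : y^T \in D by rewrite inE /D /= trmxK.
  by move/umin; rewrite /f trmxK.
by rewrite (le_trans fu)// (le_trans fy)// /f trmxK.
Qed.

Lemma euclidean_proj_in (R : realType) (n : nat) (C : set 'cV[R]_n)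
    (x : 'cV[R]_n) :
  closed C -> C !=set0 -> C (euclidean_proj C x).
Proof. by move=> Cc C0; have [] := getPex (euclidean_proj_exists x Cc C0). Qed.

(** * Linear subspaces *)

Definition is_subspace {R : realType} {n : nat} (S : set 'cV[R]_n) : Prop :=
  S 0 /\ forall (a : R) x y, S x -> S y -> S (a *: x + y).

(** A matrix of maximal rank among those whose columns span part of [S]: a
    vector of [S] outside its column space could be adjoined and would raise
    the rank. Row spaces are used for the rank theory, hence the transposes. *)
Lemma subspace_column_space (R : realType) (n : nat) (S : set 'cV[R]_n) :
  is_subspace S -> exists U : 'M[R]_n, S = range (fun z : 'cV[R]_n => U *m z).
Proof.
move=> [S0 SZD].
pose inS (W : 'M[R]_n) := forall z : 'rV[R]_n, S (z *m W)^T.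
pose P r := `[< exists2 W : 'M[R]_n, inS W & \rank W = r >].
have exP : exists r, P r.
  exists 0; apply/asboolP; exists 0; last exact: mxrank0.
  by move=> z; rewrite mulmx0 trmx0.
have leP r : P r -> (r <= n)%N.
  by move=> /asboolP[W _ <-]; exact: rank_leq_row.
case: (ex_maxnP exP leP) => _ /asboolP[W inW <-] Wmax.
exists W^T; apply/seteqP; split=> [x Sx|_ [z _ <-]]; last first.
  by rewrite -[_ *m _]trmxK trmx_mul trmxK.
pose V := (W + x^T)%MS.
(* x^T has a single row, so its multiples by z2 are scalar multiples of x *)
have inV : inS V.
  move=> z; have /sub_addsmxP[[z1 z2] /= ->] : (z *m V <= V)%MS by exact: submxMl.
  rewrite addrC linearD/= trmx_mul trmxK [z2]mx11_scalar.
  by rewrite tr_scalar_mx mul_mx_scalar; apply: SZD.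
have VW : (V <= W)%MS.
  rewrite -(mxrank_leqif_sup (addsmxSl W x^T)) eqn_leq mxrankS ?addsmxSl//=.
  by apply: Wmax; apply/asboolP; exists V.
have /submxP[z xz] := submx_trans (addsmxSr W x^T) VW.
by exists z^T => //; rewrite -trmx_mul -xz trmxK.
Qed.

(** [B] is a right inverse of [A] on [A S] with values in [S]: with [S] the
    column space of [U], take [U] times a generalized inverse of [A U]. *)
Lemma subspace_section (R : realType) (m n : nat) (A : 'M[R]_(m, n))
    (S : set 'cV[R]_n) :
  is_subspace S -> exists B : 'M[R]_(n, m),
    (forall y, S (B *m y)) /\
    (forall x, S x -> A *m (B *m (A *m x)) = A *m x).
Proof.
move=> /subspace_column_space[U ->]; exists (U *m pinvmx (A *m U)); split=> [y|].
  by exists (pinvmx (A *m U) *m y); rewrite // mulmxA.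
move=> _ [z _ <-].
have AUpAU : A *m U *m pinvmx (A *m U) *m (A *m U) = A *m U by rewrite mulmxKpV.
by rewrite [in RHS]mulmxA -[in RHS]AUpAU !mulmxA.
Qed.

(** * Convex cones and their relative interiors *)

Lemma one_sub_half (R : realType) : 1 - 2^-1 = 2^-1 :> R.
Proof. by rewrite {1}(splitr 1) div1r addrK. Qed.

Lemma cone_scale (R : realType) (n : nat) (K : set 'cV[R]_n) (l : R) x :
  is_cone K -> 0 < l -> K x -> K (l *: x).
Proof. by move=> K_cone l0 Kx; rewrite (K_cone _ l0); exists x. Qed.

Lemma sub_affine_hull (R : realType) (n : nat) (K : set 'cV[R]_n) :
  K `<=` affine_hull K.
Proof. exact: sub_smallest. Qed.

(** With a point [k] a cone contains [2 k], so the line through these two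
    points puts the origin in the affine hull, even when the cone itself
    misses it. *)
Lemma cone_affine_hull_subspace (R : realType) (n : nat) (K : set 'cV[R]_n) :
  is_cone K -> K !=set0 -> is_subspace (affine_hull K).
Proof.
move=> K_cone [k Kk].
have aff x y t : affine_hull K x -> affine_hull K y ->
    affine_hull K ((1 - t) *: x + t *: y).
  move=> Sx Sy M [M_aff KM].
  by apply: (M_aff); [apply: Sx | apply: Sy]; split.
have S0 : affine_hull K 0.
  have K2 : K (2 *: k) by exact: cone_scale.
  have := aff _ _ (-1) (sub_affine_hull Kk) (sub_affine_hull K2).
  by rewrite opprK scalerA mulN1r -scalerDl subrr scale0r.
have SZ a x : affine_hull K x -> affine_hull K (a *: x).
  by move=> /(aff _ _ a S0); rewrite scaler0 add0r.
(* a x + y is the midpoint of 2 a x and 2 y *)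
split=> // a x y /(SZ (2 * a)) Sx /(SZ 2) Sy.
have := aff _ _ 2^-1 Sx Sy.
rewrite one_sub_half.
by rewrite !scalerA mulrA mulVf ?mul1r ?scale1r// pnatr_eq0.
Qed.

(** The sum is twice the midpoint. *)
Lemma convex_cone_add (R : realType) (n : nat) (K : set 'cV[R]_n) x y :
  is_cone K -> convex_set (K : set (convex_lmodType 'cV[R]_n)) ->
  K x -> K y -> K (x + y).
Proof.
move=> K_cone K_convex Kx Ky.
have h01 : 0 <= (2^-1 : R) <= 1 by rewrite invr_ge0 ler0n invf_le1 ?ltr0n// ler1n.
have /= := K_convex x y (Itv01 (proj1 (andP h01)) (proj2 (andP h01)))
  (mem_set Kx) (mem_set Ky).
rewrite inE /conv /= => /(cone_scale K_cone (ltr0Sn _ 1)).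
by rewrite /unstable.onem one_sub_half -scalerDr scalerA mulfV ?scale1r// pnatr_eq0.
Qed.

Lemma relint_near (R : realType) (n : nat) (K : set 'cV[R]_n) (d : 'cV[R]_n) :
  is_subspace (affine_hull K) -> relint K d ->
  \forall e \near (0 : 'cV[R]_n), affine_hull K e -> relint K (d + e).
Proof.
move=> [_ SZD] [Sd /nbhs_interior/nbhs0P].
apply: filterS => e Ke Se; split => //.
by rewrite -[d]scale1r; exact: SZD.
Qed.

(** A neighbourhood of [u] in the span of [K], translated by [y], is a
    neighbourhood of [y + u] in the span, and it stays in [K] because [K] is
    closed under addition. *)
Lemma relint_addl (R : realType) (n : nat) (K : set 'cV[R]_n) (y u : 'cV[R]_n) :
  is_cone K -> convex_set (K : set (convex_lmodType 'cV[R]_n)) ->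
  K y -> relint K u -> relint K (y + u).
Proof.
move=> K_cone K_convex Ky [Su Ku].
have [_ SZD] := cone_affine_hull_subspace K_cone (ex_intro _ y Ky).
have Sy := sub_affine_hull Ky; split.
  by rewrite -[y]scale1r; exact: SZD.
apply/nbhs0P; move/nbhs0P: Ku; apply: filterS => e Ke Se.
rewrite -addrA; apply: convex_cone_add => //; apply: Ke.
have -> : u + e = (-1) *: y + (y + u + e) by rewrite scaleN1r -addrA addKr.
exact: SZD.
Qed.

(** * Feasibility after the shift *)

Lemma closure_eq_cst (T U : topologicalType) (f : T -> U) (D : set T) (c : U) :
  hausdorff_space U -> continuous f -> (forall x, D x -> f x = c) ->
  forall x, closure D x -> f x = c.
Proof.
move=> hU f_cont fD x Dx.
suff f_closed : closed (f @^-1` [set c]).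
  by apply: f_closed; apply: closureS Dx => y; exact: fD.
apply: preimage_closed => [//|].
exact: accessible_closed_set1 (hausdorff_accessible hU) _.
Qed.

(** The point reached is [y + d + B A e], where [y - x] is a point of
    [K - {x | A x = b}] near [v], the vector [e = v - (y - x)] is the error,
    and [B] sends vectors of [A S] to preimages in the span [S] of [K].
    The error itself may leave [S], while [B A e] is a small vector of [S]
    with the same image under [A], so that [d + B A e] is still relatively
    interior. That [A e] lies in [A S] uses the finite dimension: [A B A - A]
    vanishes on [K], hence is constant on [K - {x | A x = b}] and, by
    continuity, takes the same value at [v]. *)
Lemma strongly_feasible_of_closure (R : realType) (m n : nat)
    (K : set 'cV[R]_n) (b : 'cV[R]_m) (A : 'M[R]_(m, n)) (v d : 'cV[R]_n) :
  is_cone K -> convex_set (K : set (convex_lmodType 'cV[R]_n)) ->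
  closure (minkowski_diff K [set x : 'cV[R]_n | A *m x = b]) v ->
  relint K d ->
  relint K `&` [set x : 'cV[R]_n | A *m (x - v - d) = b] !=set0.
Proof.
move=> K_cone K_convex; set D := minkowski_diff _ _ => Dv d_relint.
have K_nonempty : K !=set0.
  by have [_ [[y Ky _] _]] := Dv _ filterT; exists y.
have S_subspace := cone_affine_hull_subspace K_cone K_nonempty.
have [B [BS BA]] := subspace_section A S_subspace.
pose Q : 'M[R]_(m, n) := A *m B *m A - A.
have Qv : Q *m v = - (A *m (B *m b) - b).
  apply: (closure_eq_cst (f := mulmx Q) (D := D)) (Dv); first exact: norm_hausdorff.
    exact: mulmx_continuous.
  move=> _ [y Ky [x /= Ax <-]].
  rewrite mulmxBr !mulmxBl -!mulmxA Ax BA; last exact: sub_affine_hull.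
  by rewrite subrr sub0r.
have near_v : \forall z \near v, relint K (d + B *m (A *m (v - z))).
  have BA_cont : continuous (fun z : 'cV[R]_n => B *m (A *m (v - z))).
    move=> z; apply: (@continuous_comp _ _ _ (fun z : 'cV[R]_n => v - z)
      (fun e : 'cV[R]_n => B *m (A *m e))).
      exact: (cvgB (cvg_cst v) (@cvg_id _ (nbhs z))).
    apply: (@continuous_comp _ _ _ (mulmx A) (mulmx B)).
      exact: mulmx_continuous.
    exact: mulmx_continuous.
  have near0 := relint_near S_subspace d_relint.
  have := BA_cont v; rewrite /continuous_at subrr !mulmx0 => cvg0.
  move: (cvg0 _ near0); apply: (@filterS _ (nbhs v)) => z /=.
  by apply; exact: BS.
have [_ [[y Ky [x /= Ax <-]] yx_near]] := Dv _ near_v.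
set e := v - (y - x) in yx_near.
exists (y + (d + B *m (A *m e))); split; first exact: relint_addl.
have Ae : A *m (B *m (A *m e)) = A *m e.
  apply/eqP; rewrite -subr_eq0; apply/eqP.
  transitivity (Q *m e); first by rewrite mulmxBl !mulmxA.
  rewrite mulmxBr Qv mulmxBr !mulmxBl -!mulmxA Ax BA; last exact: sub_affine_hull.
  by rewrite subrr sub0r subrr.
rewrite /= (_ : _ - v - d = y + B *m (A *m e) - v); last first.
  by rewrite addrCA [LHS]addrAC [d + _]addrC addrK.
rewrite mulmxBr mulmxDr Ae -mulmxDr -mulmxBr -Ax; congr (_ *m _).
by rewrite /e opprB addrCA [y + _]addrC subrK [v + x]addrC addrK.
Qed.

Unset Implicit Arguments.
Set Strict Implicit.

Theorem theorem8 (R : realType) (m n : nat) (K : set 'cV[R]_n)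
    (b : 'cV[R]_m) (A : 'M[R]_(m, n)) (v d : 'cV[R]_n)
    (K_nonempty : K !=set0)
    (K_closed : closed K)
    (K_convex : convex_set (K : set (convex_lmodType 'cV[R]_n)))
    (K_cone : is_cone K)
    (le_mn : (m <= n)%N)
    (A_full_rank : \rank A = m)
    (v_def : v = euclidean_proj
       (closure (minkowski_diff K [set x : 'cV[R]_n | A *m x = b])) 0)
    (d_relint : relint K d) :
  relint K `&` [set x : 'cV[R]_n | A *m (x - v - d) = b] !=set0.
Proof.
apply: strongly_feasible_of_closure => //.
rewrite v_def; apply: euclidean_proj_in; first exact: closed_closure.
have [k Kk] := K_nonempty.
have freeA : row_free A by rewrite /row_free A_full_rank.
exists (k - pinvmx A *m b); apply: subset_closure; exists k => //.
by exists (pinvmx A *m b); rewrite //= mulmxA mulmxVp// mul1mx.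
Qed.
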